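(* Let $Q$ be the law of $Y=X+\sigma Z$, where $X\sim P$ is a real random variable with a Lebesgue density, $Z\sim\mathcal N(0,1)$ is independent of $X$ and $\sigma>0$; let $q$ be the density of $Q$, and let $Y_1,\dots,Y_n$ be i.i.d. samples from $Q$. Let $m\ge0$ be an integer and let $\phi(z)=\frac1{\sqrt{2\pi}}e^{-z^2/2}$. For a bandwidth $b>0$ define $$\widehat q^{(m)}_b(y)=\frac1{n\,b^{m+1}}\sum_{i=1}^n\phi^{(m)}\Big(\frac{y-Y_i}{b}\Big).$$ Suppose $q\in\mathcal H^{m+2}(L)$ for some $L>0$. Then, with the bandwidth choice $b_m\asymp n^{-\frac1{2m+5}}$ (that is, $c_1n^{-\frac1{2m+5}}\le b_m\le c_2n^{-\frac1{2m+5}}$ with constants $0<c_1\le c_2$ depending only on $L$ and $m$), there is a constant $C$ depending only on $L$ and $m$ such that for every fixed $y\in\mathbb R$ and all sufficiently large $n$, $$\mathbb E\Big|\widehat q^{(m)}_{b_m}(y)-q^{(m)}(y)\Big|^2\le C\,n^{-\frac4{2m+5}}.$$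
   Context: Hölder class: for $\alpha>0$ let $\lfloor\alpha\rfloor$ denote the largest integer strictly less than $\alpha$ (so $\lfloor m+2\rfloor=m+1$). For $L>0$, $\mathcal H^\alpha(L)$ is the set of functions $f:\mathbb R\to\mathbb R$ with $$\max_{0\le k\le\lfloor\alpha\rfloor}\sup_{x\in\mathbb R}|f^{(k)}(x)|+\sup_{x\ne y\in\mathbb R}\frac{|f^{(\lfloor\alpha\rfloor)}(x)-f^{(\lfloor\alpha\rfloor)}(y)|}{|x-y|^{\alpha-\lfloor\alpha\rfloor}}\le L.$$ $f^{(m)}$ denotes the $m$-th derivative of $f$. *)

(* Defs.v *)
From HB Require Import structures.
From mathcomp Require Import all_boot all_order all_algebra.
From mathcomp Require Import all_classical all_reals all_analysis.
Import Order.TTheory GRing.Theory Num.Theory.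
Import numFieldNormedType.Exports.
Set Implicit Arguments.
Unset Strict Implicit.
Unset Printing Implicit Defensive.
Local Open Scope classical_set_scope.
Local Open Scope ring_scope.

(* Largest integer strictly less than alpha; it is nonnegative, and the absolute
   value is harmless, exactly when 0 < alpha. *)
Definition strict_floor (R : realType) (alpha : R) : nat :=
  `|Num.ceil alpha - 1|%N.

Lemma strict_floorP (R : realType) (alpha : R) (k : int) : 0 < alpha ->
  (k%:~R < alpha) = (k <= (strict_floor alpha)%:Z).
Proof.
move=> a0; rewrite /strict_floor gez0_abs ?subr_ge0 -?gtz0_ge1 ?ceil_gt0//.
by rewrite lerBrDr lezD1 ceil_gt_int.
Qed.

Lemma strict_floor_natr (R : realType) (n : nat) :
  strict_floor (n.+1%:R : R) = n.
Proof. by rewrite /strict_floor pmulrn intrKceil -addn1 PoszD addrK. Qed.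

(* derive1n is total: the existence of the derivatives has to be required.
   All the suprema are over nonempty sets of nonnegative values. *)
Definition holder_class (R : realType) (alpha L : R) : set (R -> R) :=
  [set f : R -> R | let l := strict_floor alpha in
    (forall (k : nat) (x : R), (k < l)%N -> derivable (derive1n k f) x 1) /\
    (\big[maxe/-oo]_(0 <= k < l.+1)
        ereal_sup (range (fun x : R => (`|derive1n k f x|)%:E))
     + ereal_sup [set (`|derive1n l f xy.1 - derive1n l f xy.2|
                        / `|xy.1 - xy.2| `^ (alpha - l%:R))%:E
                 | xy in [set xy : R * R | xy.1 != xy.2]]
     <= L%:E)%E].

Definition has_lebesgue_density (R : realType) (mu : set R -> \bar R)
    (p : R -> R) : Prop :=
  [/\ measurable_fun setT p,
      forall x, 0 <= p x &
      forall A : set R, measurable A ->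
        mu A = (\int[lebesgue_measure]_(x in A) (p x)%:E)%E].

Definition independent_pair (d : measure_display) (T : measurableType d)
    (R : realType) (P : probability T R) (X Z : {RV P >-> R}) : Prop :=
  forall A B : set R, measurable A -> measurable B ->
    P ((X @^-1` A) `&` (Z @^-1` B)) = (P (X @^-1` A) * P (Z @^-1` B))%E.

Definition mutually_independent (d : measure_display) (T : measurableType d)
    (R : realType) (P : probability T R) (I : finType)
    (X : I -> {RV P >-> R}) : Prop :=
  forall (J : {set I}) (A : I -> set R), (forall i, measurable (A i)) ->
    P (\bigcap_(i in [set` J]) (X i @^-1` A i)) =
    (\prod_(i in J) P (X i @^-1` A i))%E.

Definition iid_sample (d : measure_display) (T : measurableType d)
    (R : realType) (P : probability T R) (n : nat)
    (Q : set R -> \bar R) (Y : 'I_n -> {RV P >-> R}) : Prop :=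
  mutually_independent Y /\
  forall (i : 'I_n) (A : set R), measurable A -> distribution P (Y i) A = Q A.

Definition gauss_kernel (R : realType) (z : R) : R :=
  (Num.sqrt (2 * pi))^-1 * expR (- (z ^+ 2 / 2)).

Definition kde_derivative (R : realType) (m n : nat) (b : R) (ys : 'I_n -> R)
    (y : R) : R :=
  (n%:R * b ^+ m.+1)^-1 *
  \sum_(i < n) derive1n m (@gauss_kernel R) ((y - ys i) / b).

(* Main.v *)
Require Import Defs.
From HB Require Import structures.
From mathcomp Require Import all_boot all_order all_algebra.
From mathcomp Require Import all_classical all_reals all_analysis.
From mathcomp Require Import measurable_realfun ring.
Import Order.TTheory GRing.Theory Num.Theory.
Import numFieldNormedType.Exports.
Local Open Scope classical_set_scope.
Local Open Scope ring_scope.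

(** The risk is variance plus squared bias. Integrating by parts [m] times turns
    the mean of the estimator into the average of [q^(m)] against the N(y, b^2)
    density; since this density is centred at [y] and [q^(m+1)] is Lipschitz, a
    first-order Taylor expansion bounds the bias by a multiple of [L b^2]. Since
    [q <= L], the variance is at most a multiple of [L / (n b^(2m+1))]. With
    [r = n^(-1/(2m+5))] and [b] comparable to [r], both are of order [r^4]. *)

(** * The Gaussian kernel and its derivatives *)

(** All integrability, decay and size estimates go through one envelope: a derivative of the kernel
    is a polynomial times the kernel, hence below a multiple of [wide_gauss], whose integral after
    rescaling is exactly [Num.sqrt (4 * pi) * h]. The Hölder class of index [m + 2] provides only
    [m + 1] derivatives, the last one Lipschitz, so the quadratic Taylor remainder has to come from
    the mean value theorem rather than from a second derivative of [q^(m)]. Variance and bias are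
    bounded for fixed [n] and [h], with constants chosen before [L], [q] and the law. The rate is
    then pure algebra: [r^(2m+5) = 1/n] says exactly that the variance order [1 / (n r^(2m+1))]
    equals the squared bias order [r^4]. *)

Section gauss_kernel_theory.
Context {R : realType}.
Implicit Types (p : {poly R}) (z : R) (k : nat).
Local Notation K := (@gauss_kernel R).

(* Dominates every polynomial multiple of the kernel (see [poly_gauss_le]), yet
   is itself a rescaled normal density. *)
Definition wide_gauss (z : R) : R := expR (- (z ^+ 2 / 4)).

Lemma wide_gauss_ge0 z : 0 <= wide_gauss z. Proof. exact: expR_ge0. Qed.

Lemma wide_gauss_le1 z : wide_gauss z <= 1.
Proof. by rewrite -expR0 ler_expR oppr_le0 mulr_ge0 ?sqr_ge0. Qed.

Lemma is_derive_gauss_kernel z : is_derive z 1 K (- z * K z).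
Proof.
rewrite /gauss_kernel; apply: is_derive_eq.
set c := (Num.sqrt _)^-1.
by rewrite !scaler0 add0r /GRing.scale /=; field.
Qed.

Lemma is_derive_poly_gauss p z :
  is_derive z 1 (fun x => p.[x] * K x) ((p^`() - 'X * p)%R.[z] * K z).
Proof.
have dK := is_derive_gauss_kernel z.
apply: is_derive_eq; rewrite /GRing.scale /= hornerD hornerN hornerM hornerX.
ring.
Qed.

(** The polynomials are, up to sign, the Hermite polynomials, generated by [p] to [p' - X p]. Their
    coefficients never matter, so an existential is enough. *)
Lemma derive1n_gauss_kernel k :
  exists p, derive1n k K = (fun z => p.[z] * K z).
Proof.
elim: k => [|k [p pE]].
  by exists 1; apply/funext => z; rewrite derive1n0 hornerC mul1r.
exists (p^`() - 'X * p)%R; apply/funext => z.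
by rewrite derive1nS pE derive1E; have /@derive_val := is_derive_poly_gauss p z.
Qed.

Lemma derivable_derive1n_gauss k z : derivable (derive1n k K) z 1.
Proof.
have [p ->] := derive1n_gauss_kernel k.
by have /@ex_derive := is_derive_poly_gauss p z.
Qed.

Lemma derive1n1_gauss_kernel z : derive1n 1 K z = - z * K z.
Proof.
by rewrite derive1n1 derive1E; have /@derive_val := is_derive_gauss_kernel z.
Qed.

(** One term of the exponential series suffices: [t ^ (k+1) / (k+1)!] is at most [expR t], here with
    [t = z^2 / 4]. The summand [1] of the constant covers [|z| <= 1]; elsewhere [|z|^k] is below the
    even power [z^(2(k+1)) = 4^(k+1) t^(k+1)]. *)
Lemma exprn_le_expR_sqr k :
  exists2 C : R, 0 <= C & forall z, `|z| ^+ k <= C * expR (z ^+ 2 / 4).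
Proof.
exists (1 + 4 ^+ k.+1 * k.+1`!%:R); first by rewrite addr_ge0 ?mulr_ge0.
move=> z; set t := z ^+ 2 / 4.
have t0 : 0 <= t by rewrite /t mulr_ge0 ?sqr_ge0.
have zt : `|z| ^+ k <= 1 + (z ^+ 2) ^+ k.+1.
  have [z1|z1] := leP `|z| 1.
    rewrite (le_trans (exprn_ile1 k _ z1))// lerDl exprn_ge0 ?sqr_ge0//.
  rewrite -(real_normK (num_real z)) -exprM.
  rewrite (le_trans _ (_ : `|z| ^+ (2 * k.+1) <= _)) ?lerDr//.
  by rewrite ler_weXn2l ?ltW// mul2n -addnn addSn ltnW// ltnS leq_addr.
rewrite (le_trans zt)// mulrDl mul1r; apply: lerD.
  by rewrite -expR0 ler_expR.
have /(le_trans _) := expR_ge1Dxn k t0 => /(_ (t ^+ k.+1 / k.+1`!%:R)).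
rewrite lerDr => /(_ ler01).
rewrite ler_pdivrMr ?ltr0n ?fact_gt0// => h.
rewrite -mulrA [_%:R * _]mulrC (_ : z ^+ 2 = 4 * t); last by rewrite /t; field.
by rewrite exprMn ler_wpM2l.
Qed.

Lemma poly_le_expR_sqr p :
  exists2 C : R, 0 <= C & forall z, `|p.[z]| <= C * expR (z ^+ 2 / 4).
Proof.
have /choice[C CP] k : exists C : R,
    0 <= C /\ forall z, `|z| ^+ k <= C * expR (z ^+ 2 / 4).
  by have [C] := exprn_le_expR_sqr k; exists C.
exists (\sum_(i < size p) `|p`_i| * C i).
  by apply: sumr_ge0 => i _; rewrite mulr_ge0//; have [] := CP i.
move=> z; rewrite horner_coef mulr_suml (le_trans (ler_norm_sum _ _ _))//.
apply: ler_sum => i _; rewrite normrM normrX -mulrA ler_wpM2l//.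
by have [_] := CP i.
Qed.

(** The exponential [expR (- z^2 / 2)] is the product of two copies of [expR (- z^2 / 4)]: one
    absorbs the polynomial, the other is the envelope. *)
Lemma poly_gauss_le p :
  exists2 C : R, 0 <= C & forall z, `|p.[z] * K z| <= C * wide_gauss z.
Proof.
have [C C0 HC] := poly_le_expR_sqr p.
set c : R := (Num.sqrt (2 * pi))^-1.
have c0 : 0 <= c by rewrite invr_ge0 sqrtr_ge0.
exists (C * c); first by rewrite mulr_ge0.
move=> z; have -> : K z = c * (expR (- (z ^+ 2 / 4)) * wide_gauss z).
  by rewrite /gauss_kernel /wide_gauss -expRD; congr (_ * expR _); field.
rewrite normrM.
rewrite (ger0_norm (mulr_ge0 c0 (mulr_ge0 (expR_ge0 _) (wide_gauss_ge0 z)))).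
rewrite (mulrCA c) (mulrA `|_|) -[leRHS]mulrA.
rewrite ler_wpM2r ?mulr_ge0 ?wide_gauss_ge0//.
by rewrite expRN ler_pdivrMr ?expR_gt0.
Qed.

Lemma derive1n_gauss_le k :
  exists2 C : R, 0 <= C & forall z, `|derive1n k K z| <= C * wide_gauss z.
Proof. by have [p ->] := derive1n_gauss_kernel k; exact: poly_gauss_le. Qed.

(** The exponent is [- (u - y)^2 / (4 h^2)], that of a normal law of variance [2 h^2]; the prefactor
    is the inverse of the peak of its density. *)
Lemma wide_gauss_rescale (y h u : R) : 0 < h ->
  wide_gauss ((y - u) / h) =
  Num.sqrt (4 * pi) * h * normal_pdf y (h * Num.sqrt 2) u.
Proof.
move=> h0.
have s0 : 0 < h * Num.sqrt 2 by rewrite mulr_gt0// sqrtr_gt0.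
rewrite normal_pdfE ?gt_eqF//= /normal_peak /normal_fun exprMn sqr_sqrtr//.
rewrite (_ : h ^+ 2 * 2 * pi *+ 2 = h ^+ 2 * (4 * pi)); last by ring.
rewrite (sqrtrM _ (sqr_ge0 h)) sqrtr_sqr ger0_norm ?ltW//.
have p0 : 0 < Num.sqrt (4 * pi) :> R by rewrite sqrtr_gt0 mulr_gt0 ?pi_gt0.
rewrite mulrA (mulrC h) divff ?mul1r ?gt_eqF ?mulr_gt0//.
by congr expR; field; rewrite gt_eqF.
Qed.

Lemma gauss_kernel_rescale (y h u : R) : 0 < h ->
  gauss_kernel ((y - u) / h) = h * normal_pdf y h u.
Proof.
move=> h0.
rewrite normal_pdfE ?gt_eqF//= /normal_peak /normal_fun /gauss_kernel.
rewrite (_ : h ^+ 2 * pi *+ 2 = h ^+ 2 * (2 * pi)); last by ring.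
rewrite (sqrtrM _ (sqr_ge0 h)) sqrtr_sqr ger0_norm ?ltW//.
rewrite invfM !mulrA divff ?gt_eqF//.
by rewrite mul1r; congr (_ * expR _); field; rewrite gt_eqF.
Qed.

End gauss_kernel_theory.

(** * Integration by parts on the real line *)

Section integral_line.
Context {R : realType}.
Local Notation mu := (@lebesgue_measure R).
Local Notation K := (@gauss_kernel R).
Implicit Types (y h u : R) (f F : R -> R) (k : nat).

Lemma integrable_wide_gauss y h : 0 < h ->
  mu.-integrable setT (EFin \o (fun u => wide_gauss ((y - u) / h))).
Proof.
move=> h0; apply: (@eq_integrable _ _ _ mu setT measurableT (fun u =>
  ((Num.sqrt (4 * pi) * h)%:E * (normal_pdf y (h * Num.sqrt 2) u)%:E)%E)) => //.
  by move=> u _ /=; rewrite wide_gauss_rescale.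
by apply: integrableZl => //; exact: integrable_normal_pdf.
Qed.

Lemma Rintegral_wide_gauss y h : 0 < h ->
  \int[mu]_u wide_gauss ((y - u) / h) = Num.sqrt (4 * pi) * h.
Proof.
move=> h0; under eq_Rintegral do rewrite wide_gauss_rescale//.
rewrite RintegralZl//; last exact: integrable_normal_pdf.
by rewrite /Rintegral integral_normal_pdf mulr1.
Qed.

Lemma Rintegral_gauss_kernel y h : 0 < h ->
  \int[mu]_u K ((y - u) / h) = h.
Proof.
move=> h0; under eq_Rintegral do rewrite gauss_kernel_rescale//.
rewrite RintegralZl//; last exact: integrable_normal_pdf.
by rewrite /Rintegral integral_normal_pdf mulr1.
Qed.

Lemma integrable_le_wide_gauss C y h f : 0 < h -> measurable_fun setT f ->
  (forall u, `|f u| <= C * wide_gauss ((y - u) / h)) ->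
  mu.-integrable setT (EFin \o f).
Proof.
move=> h0 /measurable_EFinP mf fC.
have ig := integrableZl measurableT C (integrable_wide_gauss y h h0).
apply: (le_integrable measurableT _ _ ig); first exact: mf.
by move=> u _ /=; rewrite lee_fin (le_trans (fC u))// ler_norm.
Qed.

(** The fundamental theorem of calculus on growing symmetric intervals gives boundary terms that
    tend to [0], while dominated convergence with dominating function [|f|] gives the full integral.
    Integer endpoints are enough. *)
Lemma Rintegral_is_derive_eq0 F f : (forall x : R, is_derive x 1 F (f x)) ->
  continuous f -> mu.-integrable setT (EFin \o f) ->
  F n%:R @[n --> \oo] --> (0 : R) -> F (- n%:R) @[n --> \oo] --> (0 : R) ->
  \int[mu]_u f u = 0.
Proof.
move=> dF cf intf Fp Fm.
(* The successor keeps the interval nondegenerate at [n = 0], as [continuous_FTC2] requires; the two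
   limits of [F] are shifted accordingly at the end. *)
pose I n : set R := `[- n.+1%:R, n.+1%:R]%classic.
pose fn n := (EFin \o f) \_ (I n).
have mI n : measurable (I n) by exact: measurable_itv.
have mf : measurable_fun setT (EFin \o f) by exact: measurable_int intf.
have cvg1 : (\int[mu]_u fn n u)%E @[n --> \oo] --> (\int[mu]_u (f u)%:E)%E.
  apply: (@dominated_cvg _ _ _ mu setT measurableT fn _
    (abse \o (EFin \o f))) => //.
  - move=> n; apply/(measurable_restrictT _ (mI n)).
    exact: measurable_funTS.
  - move=> x _; apply: cvg_near_cst.
    near=> n.
    rewrite /fn patchE ifT// inE /I /= in_itv /= -ler_norml.
    near: n; exists (Num.truncn `|x|) => // n /= xn.
    rewrite (le_trans (ltW (truncnS_gt _)))// ler_nat ltnS //.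
  - exact: integrable_abse.
  - move=> n x _; rewrite /fn patchE; case: ifP => _ //=.
    by rewrite normr0 lee_fin.
have cvg2 : (\int[mu]_u fn n u)%E @[n --> \oo] --> 0%E.
  have IE n : (\int[mu]_u fn n u)%E = (F n.+1%:R - F (- n.+1%:R))%:E.
    rewrite -integral_mkcond EFinB.
    apply: continuous_FTC2.
    - by rewrite (lt_le_trans _ (ler0n _ _))// oppr_lt0.
    - exact: continuous_subspaceT.
    - split => [x _||].
      + by have /@ex_derive := dF x.
      + apply: cvg_at_right_filter; apply: differentiable_continuous.
        by apply/derivable1_diffP; have /@ex_derive := dF (- n.+1%:R).
      + apply: cvg_at_left_filter; apply: differentiable_continuous.
        by apply/derivable1_diffP; have /@ex_derive := dF (n.+1%:R).
    - by move=> x _; rewrite derive1E; have /@derive_val := dF x.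
  rewrite (funext IE); apply: cvg_EFin; first exact: nearW.
  rewrite -[X in _ --> X](subrr (0 : R)).
  apply: cvgB; first by rewrite -cvg_shiftS in Fp; exact: Fp.
  by rewrite -(cvg_shiftS (fun n => F (- n%:R))) in Fm; exact: Fm.
have := cvg_unique _ cvg1 cvg2.
by rewrite /Rintegral => ->.
Unshelve. all: by end_near. Qed.
End integral_line.

Section gauss_by_parts.
Context {R : realType}.
Local Notation mu := (@lebesgue_measure R).
Local Notation K := (@gauss_kernel R).
Implicit Types (y h u : R) (f g q : R -> R) (k m : nat).

Definition scaled_gauss k y h u : R := derive1n k K ((y - u) / h).

Lemma is_derive_scaled_gauss k y h u :
  is_derive u 1 (scaled_gauss k y h) (- (scaled_gauss k.+1 y h u / h)).
Proof.
have dK : is_derive ((y - u) / h) 1 (derive1n k K)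
    (derive1n k.+1 K ((y - u) / h)).
  rewrite derive1nS derive1E; apply: derivableP.
  exact: derivable_derive1n_gauss.
have dz : is_derive u 1 (fun x : R => (y - x) / h) (- h^-1).
  by apply: is_derive_eq; rewrite /GRing.scale /=; ring.
have := @is_derive1_comp R _ (fun x => (y - x) / h) u _ _ dK dz.
by rewrite mulrN.
Qed.

Lemma continuous_is_derive f g : (forall x : R, is_derive x 1 f (g x)) ->
  continuous f.
Proof.
move=> df x; apply: differentiable_continuous; apply/derivable1_diffP.
by have /@ex_derive := df x.
Qed.

Lemma continuous_scaled_gauss k y h : continuous (scaled_gauss k y h).
Proof. exact: (continuous_is_derive _ _ (is_derive_scaled_gauss k y h)). Qed.

Lemma integrable_scaled_gaussM k y h M g : 0 < h -> measurable_fun setT g ->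
  (forall u, `|g u| <= M) ->
  mu.-integrable setT (EFin \o (fun u => scaled_gauss k y h u * g u)).
Proof.
move=> h0 mg gM.
have [C C0 HC] := @derive1n_gauss_le R k.
apply: (integrable_le_wide_gauss (C * M) y h) => //.
  apply: measurable_funM => //; apply: continuous_measurable_fun.
  exact: continuous_scaled_gauss.
move=> u; rewrite normrM mulrAC; apply: ler_pM => //.
exact: HC.
Qed.

(** Completing the square gives [1 - z + z^2 / 4 = (z / 2 - 1)^2]. This trades Gaussian decay for
    exponential decay, so that along the integers the envelope is below a geometric sequence. *)
Lemma wide_gauss_le_expR (z : R) : wide_gauss z <= expR (1 - z).
Proof.
rewrite ler_expR -subr_ge0.
have -> : 1 - z - - (z ^+ 2 / 4) = (z / 2 - 1) ^+ 2 by field.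
exact: sqr_ge0.
Qed.

Lemma wide_gaussN (z : R) : wide_gauss (- z) = wide_gauss z.
Proof. by rewrite /wide_gauss sqrrN. Qed.

Lemma wide_gauss_geometric y h n : 0 < h ->
  wide_gauss ((y - n%:R) / h) <= expR (1 + y / h) * expR (- h^-1) ^+ n.
Proof.
move=> h0; rewrite -wide_gaussN (le_trans (wide_gauss_le_expR _))//.
rewrite -expRM_natl -expRD ler_expR -subr_ge0.
by rewrite [leRHS](_ : _ = 0)//; rewrite -mulr_natl; field; rewrite gt_eqF.
Qed.

Lemma cvg0_le_wide_gauss C y h f : 0 < h ->
  (forall u, `|f u| <= C * wide_gauss ((y - u) / h)) ->
  f n%:R @[n --> \oo] --> (0 : R) /\ f (- n%:R) @[n --> \oo] --> (0 : R).
Proof.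
move=> h0 fC.
have C0 : 0 <= C.
  have := le_trans (normr_ge0 _) (fC 0).
  by rewrite pmulr_lge0 ?expR_gt0.
have r1 : `|expR (- h^-1)| < 1.
  by rewrite ger0_norm ?expR_ge0// -expR0 ltr_expR oppr_lt0 invr_gt0.
(* Since the envelope is even, the limit along [- n] with centre [y] is the limit along [n] with
   centre [- y]; one statement quantified over the centre serves both. *)
suff cvg0 (a : R^nat) y' :
    (forall n, `|a n| <= C * wide_gauss ((y' - n%:R) / h)) ->
    a n @[n --> \oo] --> (0 : R).
  split; first exact: (cvg0 _ y).
  apply: (cvg0 _ (- y)) => n; rewrite -wide_gaussN.
  rewrite (_ : - ((- y - n%:R) / h) = (y - - n%:R) / h); first exact: fC.
  by ring.
move=> aC; set D := C * expR (1 + y' / h).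
have aD n : `|a n| <= geometric D (expR (- h^-1)) n.
  rewrite (le_trans (aC n))// /D /= -mulrA ler_wpM2l//.
  exact: wide_gauss_geometric.
apply: (@squeeze_cvgr _ _ _ _ (fun n => - geometric D (expR (- h^-1)) n)
  (geometric D (expR (- h^-1)))).
- apply: nearW => n; rewrite -ler_norml. exact: aD.
- rewrite -[X in _ --> X]oppr0. apply: cvgN. exact: cvg_geometric.
- exact: cvg_geometric.
Qed.

(** The product [scaled_gauss k y h * g] vanishes at infinity, so its derivative integrates to [0].
    The inner derivative [- 1 / h] of [(y - u) / h] cancels the usual minus sign, hence no
    alternating sign when the step is iterated. *)
Lemma gauss_by_parts k y h M g g' : 0 < h ->
  (forall x : R, is_derive x 1 g (g' x)) -> continuous g' ->
  (forall u, `|g u| <= M) -> (forall u, `|g' u| <= M) ->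
  \int[mu]_u (scaled_gauss k.+1 y h u * g u) =
  h * \int[mu]_u (scaled_gauss k y h u * g' u).
Proof.
move=> h0 dg cg' gM g'M.
have cg := continuous_is_derive _ _ dg.
have i1 := integrable_scaled_gaussM k.+1 y h M g h0
  (continuous_measurable_fun cg) gM.
have i2 := integrable_scaled_gaussM k y h M g' h0
  (continuous_measurable_fun cg') g'M.
have i1' : mu.-integrable setT
    (EFin \o (fun u => (- h^-1) * (scaled_gauss k.+1 y h u * g u))).
  exact: (integrableZl measurableT (- h^-1) i1).
have [C C0 HC] := @derive1n_gauss_le R k.
have sgC u : `|scaled_gauss k y h u * g u| <= C * M * wide_gauss ((y - u) / h).
  by rewrite normrM mulrAC; apply: ler_pM => //; exact: HC.
have [cp cm] := cvg0_le_wide_gauss _ _ _ _ h0 sgC.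
have : \int[mu]_u ((- h^-1) * (scaled_gauss k.+1 y h u * g u) +
                   scaled_gauss k y h u * g' u) = 0.
  apply: (Rintegral_is_derive_eq0 (fun u => scaled_gauss k y h u * g u)).
  - move=> x.
    have ds := is_derive_scaled_gauss k y h x; have dgx := dg x.
    by apply: is_derive_eq; rewrite /GRing.scale /=; ring.
  - move=> x; apply: cvgD.
      apply: cvgM; first exact: cvg_cst.
      by apply: cvgM; [exact: continuous_scaled_gauss|exact: cg].
    by apply: cvgM; [exact: continuous_scaled_gauss|exact: cg'].
  - exact: (integrableD measurableT i1' i2).
  - exact: cp.
  - exact: cm.
rewrite RintegralD// RintegralZl// => /eqP.
rewrite addr_eq0 mulNr eqr_opp => /eqP <-.
by rewrite mulrA divff ?mul1r ?gt_eqF.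
Qed.
End gauss_by_parts.

(** * Bias and second moment *)

Section kernel_smoothing.
Context {R : realType}.
Local Notation mu := (@lebesgue_measure R).
Local Notation K := (@gauss_kernel R).
Implicit Types (y h u : R) (f g q : R -> R) (k m : nat).

(** The part of the Hölder condition that repeated integration by parts consumes, in a form that
    passes from [q] to its derivative with [m] lowered by one. *)
Definition smooth_bounded m (L : R) (q : R -> R) : Prop :=
  [/\ forall k (x : R), (k < m)%N -> derivable (derive1n k q) x 1,
      forall k (x : R), (k <= m)%N -> `|derive1n k q x| <= L &
      continuous (derive1n m q)].

Lemma smooth_bounded_continuous m L q k : smooth_bounded m L q ->
  (k <= m)%N -> continuous (derive1n k q).
Proof.
move=> [dq _ cq]; rewrite leq_eqVlt => /predU1P[->//|km] x.
by apply: differentiable_continuous; apply/derivable1_diffP; exact: dq.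
Qed.

Lemma smooth_boundedS m L q : smooth_bounded m.+1 L q ->
  smooth_bounded m L (q^`())%classic.
Proof.
move=> [dq bq cq]; have E k : derive1n k (q^`())%classic = derive1n k.+1 q.
  by rewrite /derive1n iterSr.
by split => [k x km|k x km|]; rewrite E; [exact: dq|exact: bq|].
Qed.

Lemma Rintegral_scaled_gaussM m L q y h : 0 < h -> smooth_bounded m L q ->
  \int[mu]_u (scaled_gauss m y h u * q u) =
  h ^+ m * \int[mu]_u (K ((y - u) / h) * derive1n m q u).
Proof.
move=> h0; elim: m q => [|m IHm] q qS.
  by rewrite expr0 mul1r.
have [dq bq _] := qS.
have dq1 (x : R) : is_derive x 1 q (q^`()%classic x).
  by rewrite derive1E; apply: derivableP; exact: (dq 0%N).
rewrite (gauss_by_parts m y h L q _ h0 dq1).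
- rewrite IHm; last exact: smooth_boundedS.
  by rewrite mulrA -exprS /derive1n iterSr.
- exact: (smooth_bounded_continuous m.+1 L q 1).
- by move=> u; exact: (bq 0%N).
- by move=> u; exact: (bq 1%N).
Qed.

(** The mean value theorem writes the increment as [g' c * (x - y)] with [c] no farther from [y]
    than [x] is, and the Lipschitz bound compares [g' c] with [g' y]. The sharp constant [L / 2] is
    given up for this shorter route. *)
Lemma taylor1_lipschitz L g g' x y : (forall u : R, is_derive u 1 g (g' u)) ->
  (forall u v, `|g' u - g' v| <= L * `|u - v|) ->
  `|g x - g y - g' y * (x - y)| <= L * (x - y) ^+ 2.
Proof.
move=> dg g'L.
have cg := continuous_is_derive _ _ dg.
have L0 : 0 <= L.
  have := le_trans (normr_ge0 _) (g'L 1 0).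
  by rewrite subr0 normr1 mulr1.
have [c cxy ->] : exists2 c, `|c - y| <= `|x - y| & g x - g y = g' c * (x - y).
  have [xy|xy|->] := ltgtP x y; last by exists y; rewrite // !subrr mulr0.
  - have [c] := @MVT R g g' x y xy (fun u _ => dg u) (continuous_subspaceT cg).
    rewrite in_itv/= => /andP[xc cy] E.
    exists c; last by rewrite -opprB E -mulrN opprB.
    rewrite ler0_norm ?ler0_norm ?subr_le0 ?(ltW xy) ?(ltW cy)//.
    by rewrite !opprB lerB// ltW.
  - have [c] := @MVT R g g' y x xy (fun u _ => dg u) (continuous_subspaceT cg).
    rewrite in_itv/= => /andP[xc cy] E.
    exists c => //.
    by rewrite ger0_norm ?ger0_norm ?subr_ge0 ?(ltW xy) ?(ltW xc)// lerB// ltW.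
rewrite -mulrBl normrM -(real_normK (num_real (x - y))) expr2 mulrA.
by rewrite ler_wpM2r// (le_trans (g'L _ _))// ler_wpM2l.
Qed.

(** As [K' z = - z * K z], the integrand is [h] times the rescaled [K']; integrating by parts
    against the constant [1] leaves the integral of [0]. This removes the linear Taylor term from
    the bias. *)
Lemma Rintegral_gauss_centered y h : 0 < h ->
  \int[mu]_u (K ((y - u) / h) * (u - y)) = 0.
Proof.
move=> h0.
transitivity (\int[mu]_u (h * (scaled_gauss 1 y h u * 1))).
  apply: eq_Rintegral => u _.
  rewrite /scaled_gauss derive1n1_gauss_kernel mulr1.
  by field; rewrite gt_eqF.
rewrite RintegralZl//; last first.
  apply: (integrable_scaled_gaussM 1 y h 1 (cst 1)) => // u.
  by rewrite /= normr1.
rewrite (gauss_by_parts 0 y h 1 (cst 1) (cst 0)) => //.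
- under eq_Rintegral do rewrite /= mulr0.
  by rewrite /Rintegral integral0 !mulr0.
- by move=> x; exact: cvg_cst.
- by move=> u; rewrite /= normr1.
- by move=> u; rewrite /= normr0.
Qed.

(** With [z = (y - u) / h] one has [(u - y)^2 = h^2 z^2], and [z^2 * K z] is below the envelope,
    whose integral gives the third factor [h]. A general [f] is allowed so that the Taylor remainder
    can be inserted. *)
Lemma gauss_sqr_moment : exists2 C : R, 0 <= C & forall y h f, 0 < h ->
  measurable_fun setT f ->
  (forall u, `|f u| <= (u - y) ^+ 2) ->
  mu.-integrable setT (EFin \o (fun u => K ((y - u) / h) * f u)) /\
  \int[mu]_u `|K ((y - u) / h) * f u| <= C * h ^+ 3.
Proof.
have [C C0 HC] := @poly_gauss_le R 'X^2.
exists (C * Num.sqrt (4 * pi)); first by rewrite mulr_ge0 ?sqrtr_ge0.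
move=> y h f h0 mf fle.
have le1 u : `|K ((y - u) / h) * f u| <= C * h ^+ 2 * wide_gauss ((y - u) / h).
  have := HC ((y - u) / h); rewrite hornerXn normrM ger0_norm ?sqr_ge0// => H.
  rewrite [leRHS]mulrAC normrM (le_trans (ler_wpM2l (normr_ge0 _) (fle u)))//.
  rewrite -ler_pdivrMr ?exprn_gt0// (le_trans _ H)// le_eqVlt; apply/orP; left.
  by apply/eqP; field; rewrite gt_eqF.
have mK : measurable_fun setT (fun u => K ((y - u) / h)).
  apply: continuous_measurable_fun; exact: (@continuous_scaled_gauss R 0 y h).
have int1 : mu.-integrable setT (EFin \o (fun u => K ((y - u) / h) * f u)).
  apply: (integrable_le_wide_gauss _ y h _ h0 _ le1).
  exact: measurable_funM.
split => //.
have iw := integrable_wide_gauss y h h0.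
rewrite (_ : _ * h ^+ 3 = C * h ^+ 2 * (Num.sqrt (4 * pi) * h)); last by ring.
rewrite -(Rintegral_wide_gauss y h h0) -RintegralZl//.
apply: le_Rintegral => //.
- exact: integrable_norm.
- exact: (integrableZl measurableT (C * h ^+ 2) iw).
Qed.

(** The kernel is left unnormalised, with total mass [h]; this accounts for [h * g y] and for [h^3]
    in place of [h^2]. *)
Lemma gauss_bias_le : exists2 C : R, 0 <= C & forall L y h g g', 0 < h ->
  (forall u : R, is_derive u 1 g (g' u)) ->
  (forall u, `|g u| <= L) ->
  (forall u v, `|g' u - g' v| <= L * `|u - v|) ->
  `|\int[mu]_u (K ((y - u) / h) * g u) - h * g y| <= C * L * h ^+ 3.
Proof.
have [C C0 HC] := gauss_sqr_moment.
exists C => // L y h g g' h0 dg gL g'L.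
have cg := continuous_is_derive _ _ dg.
have L0 : 0 <= L by rewrite (le_trans _ (gL 0)).
(* The remainder is about to be divided by [L], to fit the bound [(u - y)^2] of the moment lemma. If
   [L = 0], then [g] vanishes identically. *)
have [L_eq0|L_neq0] := eqVneq L 0.
  have g0 u : g u = 0 by apply/eqP; rewrite -normr_le0 -L_eq0.
  rewrite g0 !mulr0 subr0 L_eq0 mulr0 mul0r.
  under eq_Rintegral do rewrite g0 mulr0.
  by rewrite /Rintegral integral0 normr0.
have Lp : 0 < L by rewrite lt_def L_neq0.
pose r u := (g u - g y - g' y * (u - y)) / L.
have mg := continuous_measurable_fun cg.
have mr : measurable_fun setT r.
  apply: measurable_funM => //; apply: measurable_funB.
    exact: measurable_funB.
  by apply: measurable_funM => //; exact: measurable_funB.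
have rle u : `|r u| <= (u - y) ^+ 2.
  rewrite /r normrM normfV (ger0_norm L0) ler_pdivrMr// [leRHS]mulrC.
  exact: taylor1_lipschitz.
have [ir rC] := HC y h r h0 mr rle.
have i1 : mu.-integrable setT (EFin \o (fun u => K ((y - u) / h) * g u)).
  exact: (integrable_scaled_gaussM 0 y h L g).
have i2 : mu.-integrable setT (EFin \o (fun u => L * (K ((y - u) / h) * r u))).
  exact: (integrableZl measurableT L ir).
have i3 : mu.-integrable setT (EFin \o (fun u => K ((y - u) / h))).
  rewrite (_ : (fun u => _) = (fun u => scaled_gauss 0 y h u * cst 1 u)).
    apply: (integrable_scaled_gaussM 0 y h 1 (cst 1)) => // u.
    by rewrite /= normr1.
  by apply: boolp.funext => u; rewrite mulr1.
have i4 : mu.-integrable setT (EFin \o (fun u => g y * K ((y - u) / h))).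
  exact: (integrableZl measurableT (g y) i3).
have i5 : mu.-integrable setT (EFin \o (fun u => K ((y - u) / h) * (u - y))).
  rewrite (_ : (fun u => _) = (fun u => h * (scaled_gauss 1 y h u * cst 1 u))).
    apply: (integrableZl measurableT h (integrable_scaled_gaussM 1 y h 1 (cst 1)
      h0 (measurable_cst _) _)) => u.
    by rewrite /= normr1.
  apply: boolp.funext => u.
  rewrite /scaled_gauss derive1n1_gauss_kernel /= mulr1.
  by field; rewrite gt_eqF.
have i6 : mu.-integrable setT
    (EFin \o (fun u => g' y * (K ((y - u) / h) * (u - y)))).
  exact: (integrableZl measurableT (g' y) i5).
have E : \int[mu]_u (K ((y - u) / h) * g u) - h * g y =
    L * \int[mu]_u (K ((y - u) / h) * r u).
  rewrite -RintegralZl//.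
  transitivity (\int[mu]_u (K ((y - u) / h) * g u - g y * K ((y - u) / h)
      - g' y * (K ((y - u) / h) * (u - y)))).
    rewrite RintegralB//; last exact: (integrableB measurableT i1 i4).
    rewrite RintegralB// (RintegralZl _ measurableT i3).
    rewrite (RintegralZl _ measurableT i5) Rintegral_gauss_kernel//.
    by rewrite Rintegral_gauss_centered// mulr0 subr0 mulrC.
  by apply: eq_Rintegral => u _; rewrite /r; field.
rewrite E normrM (ger0_norm L0) -(mulrA C) (mulrCA C) ler_wpM2l//.
by rewrite (le_trans (le_normr_Rintegral _ ir)).
Qed.

(** The envelope is at most [1], so its square is again below the envelope, whose integral is
    known. *)
Lemma scaled_gauss_sqr_le m : exists2 C : R, 0 <= C & forall L y h q, 0 < h ->
  measurable_fun setT q ->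
  (forall u, `|q u| <= L) ->
  \int[mu]_u (scaled_gauss m y h u ^+ 2 * q u) <= C * L * h.
Proof.
have [C C0 HC] := @derive1n_gauss_le R m.
exists (C ^+ 2 * Num.sqrt (4 * pi)).
  by rewrite mulr_ge0 ?sqr_ge0 ?sqrtr_ge0.
move=> L y h q h0 mq qL.
have L0 : 0 <= L by rewrite (le_trans _ (qL 0)).
have le1 u : `|scaled_gauss m y h u ^+ 2 * q u| <=
    C ^+ 2 * L * wide_gauss ((y - u) / h).
  rewrite normrM normrX [leRHS]mulrAC; apply: ler_pM => //.
  have /(lerXn2r 2) := HC ((y - u) / h).
  rewrite !nnegrE mulr_ge0 ?wide_gauss_ge0// => /(_ (normr_ge0 _) isT) H.
  rewrite (le_trans H)// exprMn ler_wpM2l ?sqr_ge0//.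
  by rewrite expr2 ler_piMr ?wide_gauss_ge0 ?wide_gauss_le1.
have iw := integrable_wide_gauss y h h0.
rewrite (_ : _ * _ * h = C ^+ 2 * L * (Num.sqrt (4 * pi) * h)); last by ring.
rewrite -(Rintegral_wide_gauss y h h0) -RintegralZl//.
apply: le_Rintegral => //.
- apply: (integrable_le_wide_gauss _ y h _ h0 _ le1).
  apply: measurable_funM => //; apply: measurable_funX.
  apply: continuous_measurable_fun; exact: continuous_scaled_gauss.
- exact: (integrableZl measurableT (C ^+ 2 * L) iw).
- by move=> u _; rewrite (le_trans (ler_norm _)).
Qed.

End kernel_smoothing.

(** * Empirical means of i.i.d. samples *)

Section iid_mean_square.
Context {R : realType}.
Local Notation mu := (@lebesgue_measure R).

Lemma integrable_bounded d (T : measurableType d) (P : probability T R)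
    (f : T -> R) (M : R) : measurable_fun setT f -> (forall x, `|f x| <= M) ->
  P.-integrable setT (EFin \o f).
Proof.
move=> mf fM; apply: measurable_bounded_integrable => //.
  by rewrite (le_lt_trans (probability_le1 _ _)) ?ltry.
exists M; split; first exact: num_real.
by move=> x Mx y _; exact: le_trans (fM y) (ltW Mx).
Qed.

(* [lebesgue_measure] lives on [measurableTypeR R], whose display differs from
   the one of [R]: the Radon-Nikodym argument is run there and transported along
   the identity map. *)
Let Rintegral_density_lebesgue (nu : probability (measurableTypeR R) R)
    (q g : R -> R) (M : R) : has_lebesgue_density nu q ->
  measurable_fun setT g -> (forall x, `|g x| <= M) ->
  \int[nu]_x g x = \int[mu]_x (g x * q x).
Proof.
move=> [mq q0 nuq] mg gM.
have numu : nu `<< mu.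
  apply/null_content_dominatesP => A mA A0.
  rewrite nuq//; apply: null_set_integral => //.
  by apply/measurable_EFinP; exact: measurable_funTS.
have ig : nu.-integrable setT (EFin \o g).
  exact: (integrable_bounded _ (measurableTypeR R) nu g M mg gM).
congr fine.
rewrite -(Radon_Nikodym_change_of_variables numu measurableT ig).
apply: ae_eq_integral => //.
- apply: emeasurable_funM; first exact/measurable_EFinP.
  exact: measurable_int (Radon_Nikodym_integrable _).
- by apply/measurable_EFinP; exact: measurable_funM.
(* Both functions integrate to [nu E] over every measurable [E], hence agree almost everywhere. *)
- have : ae_eq mu setT (Radon_Nikodym (charge_of_finite_measure nu) mu)
      (EFin \o q).
    apply: integral_ae_eq => //.
    + exact: Radon_Nikodym_integrable.
    + exact/measurable_EFinP.
    + move=> E _ mE; rewrite -Radon_Nikodym_integral// -nuq//.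
  by apply: filterS => x /= + _ => /(_ I) ->.
Qed.

Lemma measurable_id_lebesgue :
  @measurable_fun _ _ R (measurableTypeR R) setT id.
Proof. by move=> _ A mA; rewrite setTI; exact: mA. Qed.

Lemma Rintegral_density (nu : probability R R) (q g : R -> R)
    (M : R) : has_lebesgue_density nu q ->
  measurable_fun setT g -> (forall x, `|g x| <= M) ->
  \int[nu]_x g x = \int[mu]_x (g x * q x).
Proof.
move=> [mq q0 nuq] mg gM.
pose phi : {RV nu >-> measurableTypeR R} :=
    @mfun_Sub _ _ R (measurableTypeR R) id (mem_set measurable_id_lebesgue).
have Hphi : has_lebesgue_density (distribution nu phi) q by split.
rewrite -(Rintegral_density_lebesgue (distribution nu phi) q g M Hphi mg gM).
congr fine; rewrite integral_distribution//.
  by apply/measurable_EFinP.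
exact: integrable_bounded mg gM.
Qed.

Lemma Rintegral_probability_cst d (T : measurableType d) (P : probability T R)
    (r : R) : \int[P]_w r = r.
Proof.
rewrite Rintegral_cst// -[RHS]mulr1; congr (_ * _).
rewrite -[RHS]/(fine 1%E); congr fine; exact: probability_setT.
Qed.

Lemma Rintegral_sum d (T : measurableType d) (P : {measure set T -> \bar R})
    (I : Type) (s : seq I) (f : I -> T -> R) :
  (forall i, P.-integrable setT (EFin \o f i)) ->
  P.-integrable setT (EFin \o (fun w => \sum_(i <- s) f i w)) /\
  \int[P]_w (\sum_(i <- s) f i w) = \sum_(i <- s) \int[P]_w f i w.
Proof.
move=> fi; elim: s => [|i s [IHi IHs]].
  under eq_Rintegral do rewrite big_nil.
  rewrite big_nil /Rintegral integral0; split => //.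
  under eq_fun do rewrite big_nil.
  exact: integrable0.
have E : (fun w => \sum_(i <- i :: s) f i w) =
    (fun w => f i w + \sum_(i <- s) f i w).
  by apply: boolp.funext => w; rewrite big_cons.
rewrite E big_cons -IHs RintegralD//; split => //.
exact: (integrableD measurableT (fi i) IHi).
Qed.

Lemma iid_sample_pair d (T : measurableType d) (P : probability T R) n
    (nu : probability R R) (S : 'I_n -> {RV P >-> R}) i j A B :
  iid_sample nu S -> i != j -> measurable A -> measurable B ->
  P (S i @^-1` A `&` S j @^-1` B) = (nu A * nu B)%E.
Proof.
move=> [indep idd] ij mA mB.
(* Mutual independence is applied to the index set [{i, j}]; the value of [C] at other indices does
   not enter. *)
pose C k := if k == i then A else B.
have mC k : measurable (C k) by rewrite /C; case: ifP.
have := indep [set i; j]%SET C mC.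
rewrite big_setU1 ?inE//= big_set1 /C eqxx eq_sym (negbTE ij).
rewrite -(idd i A mA) -(idd j B mB) => <-; congr (P _); apply/seteqP; split.
- move=> w [wA wB] k /=; rewrite !inE => /orP[/eqP->|/eqP->].
    by rewrite eqxx.
  by rewrite eq_sym (negbTE ij).
- move=> w wC; split.
    have := wC i; rewrite /= !inE eqxx => /(_ isT) //.
  have := wC j; rewrite /= !inE eqxx orbT => /(_ isT).
  by rewrite eq_sym (negbTE ij).
Qed.

Lemma iid_sample_distribution d (T : measurableType d) (P : probability T R) n
    (nu : probability R R) (S : 'I_n -> {RV P >-> R})
    (g : R -> R) (M : R) i :
  iid_sample nu S -> measurable_fun setT g -> (forall x, `|g x| <= M) ->
  \int[P]_w g (S i w) = \int[nu]_x g x.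
Proof.
move=> [_ idd] mg gM; congr fine.
have mS : measurable_fun setT (fun w => g (S i w)).
  by apply: measurableT_comp.
have ig := integrable_bounded _ _ P _ M mS (fun w => gM (S i w)).
rewrite -(@integral_distribution _ _ T R R P (S i) (EFin \o g))//; last first.
  exact/measurable_EFinP.
apply: eq_measure_integral => A mA _; exact: idd.
Qed.

(** The joint law of [S i] and [S j] agrees with [nu \x nu] on rectangles, hence everywhere, and
    Fubini factors the integral. This makes the covariances vanish. *)
Lemma iid_sample_product d (T : measurableType d) (P : probability T R) n
    (nu : probability R R) (S : 'I_n -> {RV P >-> R})
    (g h : R -> R) (M : R) i j :
  iid_sample nu S -> i != j ->
  measurable_fun setT g -> (forall x, `|g x| <= M) ->
  measurable_fun setT h -> (forall x, `|h x| <= M) ->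
  \int[P]_w (g (S i w) * h (S j w)) = (\int[nu]_x g x) * (\int[nu]_x h x).
Proof.
move=> iid ij mg gM mh hM.
have M0 : 0 <= M by rewrite (le_trans _ (gM 0)).
have mphi : measurable_fun setT (fun w => (S i w, S j w)).
  exact: measurable_fun_pair.
pose phi : {RV P >-> (R * R)%type} :=
  @mfun_Sub _ _ T (R * R)%type (fun w => (S i w, S j w)) (mem_set mphi).
pose f (z : R * R) := g z.1 * h z.2.
have mf : measurable_fun setT f.
  by apply: measurable_funM; exact: measurableT_comp.
have fM z : `|f z| <= M * M by rewrite normrM ler_pM.
have phiE A : measurable A -> (nu \x nu)%E A = distribution P phi A.
  apply: product_measure_unique => B C mB mC.
  rewrite -(iid_sample_pair _ _ P n nu S i j B C iid ij mB mC).
  by congr (P _); apply/seteqP; split.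
have inu : (nu \x nu)%E.-integrable setT (EFin \o f).
  exact: (integrable_bounded _ _ (nu \x nu)%E _ _ mf fM).
have ih := integrable_bounded _ _ nu _ _ mh hM.
rewrite /Rintegral.
rewrite [X in fine X = _](_ : _ =
  \int[distribution P phi]_z (f z)%:E)%E; last first.
  rewrite integral_distribution//; first exact/measurable_EFinP.
  apply: (integrable_bounded _ _ P _ (M * M)) => //.
  exact: measurableT_comp.
rewrite -(eq_measure_integral (distribution P phi) (fun A mA _ => phiE A mA)).
rewrite -(integral12_prod_meas1 inu).
transitivity (\int[nu]_x ((\int[nu]_y h y) * g x)); last first.
  by rewrite RintegralZl// 1?mulrC//; exact: integrable_bounded mg gM.
congr fine; apply: eq_integral => x _; rewrite /fubini_F /f /=.
under eq_integral do rewrite EFinM.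
rewrite integralZl// mulrC EFinM; congr (_ * _)%E.
by rewrite /Rintegral fineK// integrable_fin_num.
Qed.

(** After centring, the error is [a * sz + b] with a deterministic bias [b]. Squaring leaves [b^2]
    and the diagonal terms of [sz^2], each a variance and so at most the second moment [m2]. *)
Lemma iid_mean_square d (T : measurableType d) (P : probability T R) n
    (nu : probability R R) (S : 'I_n -> {RV P >-> R})
    (g : R -> R) (M a c : R) :
  iid_sample nu S -> measurable_fun setT g -> (forall x, `|g x| <= M) ->
  ('E_P[fun w => (`|a * \sum_(i < n) g (S i w) - c| ^+ 2)%R] <=
   (a ^+ 2 * (n%:R * \int[nu]_x (g x ^+ 2)) +
     (a * (n%:R * \int[nu]_x g x) - c) ^+ 2)%:E)%E.
Proof.
move=> iid mg gM.
set m1 := \int[nu]_x g x; set m2 := \int[nu]_x (g x ^+ 2).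
have M0 : 0 <= M by rewrite (le_trans _ (gM 0)).
pose z i w := g (S i w) - m1.
have ig := integrable_bounded _ _ nu _ _ mg gM.
pose M' := M + `|m1|.
have m1M : M <= M' by rewrite lerDl.
have gM' x : `|g x - m1| <= M' by rewrite (le_trans (ler_normB _ _))// lerD2r.
have mg' : measurable_fun setT (fun x => g x - m1) by exact: measurable_funB.
have g'0 : \int[nu]_x (g x - m1) = 0.
  rewrite RintegralB//; last exact: finite_measure_integrable_cst.
  by rewrite Rintegral_probability_cst subrr.
have zE i : \int[P]_w z i w = 0.
  exact: etrans (iid_sample_distribution _ _ P n nu S _ _ i iid mg' gM') g'0.
have mz i : measurable_fun setT (z i).
  by apply: measurable_funB => //; exact: measurableT_comp.
have zM i w : `|z i w| <= M' by exact: gM'.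
have iz i := integrable_bounded _ _ P _ _ (mz i) (zM i).
have izz i j : P.-integrable setT (EFin \o (fun w => z i w * z j w)).
  apply: (integrable_bounded _ _ P _ (M' * M')).
    exact: measurable_funM.
  by move=> w; rewrite normrM ler_pM.
have zzE i j : i != j -> \int[P]_w (z i w * z j w) = 0.
  move=> ij.
  rewrite (iid_sample_product _ _ P n nu S _ _ M' i j iid ij mg' gM' mg' gM').
  by rewrite g'0 mul0r.
have zzle i : \int[P]_w (z i w * z i w) <= m2.
  rewrite (iid_sample_distribution _ _ P n nu S
    (fun x => (g x - m1) * (g x - m1)) (M' * M') i iid); last 2 first.
  - exact: measurable_funM.
  - by move=> x; rewrite normrM ler_pM.
  have ig2 : nu.-integrable setT (EFin \o (fun x => g x ^+ 2)).
    apply: (integrable_bounded _ _ nu _ (M ^+ 2)); first exact: measurable_funX.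
    by move=> x; rewrite normrX lerXn2r ?nnegrE.
  have ig1 : nu.-integrable setT (EFin \o (fun x => (2 * m1) * (g x - m1))).
    apply: (integrable_bounded _ _ nu _ (`|2 * m1| * M')).
      exact: measurable_funM.
    by move=> x; rewrite normrM ler_pM.
  have ic : nu.-integrable setT (EFin \o cst (m1 ^+ 2)).
    exact: finite_measure_integrable_cst.
  (* Grouped so that the middle term is a multiple of the centred [g - m1] and integrates to [0]. *)
  have -> : \int[nu]_x ((g x - m1) * (g x - m1)) =
      \int[nu]_x (g x ^+ 2 - 2 * m1 * (g x - m1) - m1 ^+ 2).
    by apply: eq_Rintegral => x _; ring.
  rewrite RintegralB//; last exact: (integrableB measurableT ig2 ig1).
  rewrite RintegralB// RintegralZl//; last exact: integrable_bounded mg' gM'.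
  by rewrite g'0 mulr0 subr0 Rintegral_probability_cst lerBlDr lerDl sqr_ge0.
pose b := a * (n%:R * m1) - c.
pose dz w := \sum_(i < n) \sum_(j < n) z i w * z j w.
pose sz w := \sum_(i < n) z i w.
have [isz szE] := Rintegral_sum _ _ P _ (index_enum 'I_n) z iz.
have idz1 i := Rintegral_sum _ _ P _ (index_enum 'I_n)
  (fun j w => z i w * z j w) (izz i).
have [idz dzE] := Rintegral_sum _ _ P _ (index_enum 'I_n)
  (fun i w => \sum_(j < n) z i w * z j w) (fun i => (idz1 i).1).
have iadz : P.-integrable setT (EFin \o (fun w => a ^+ 2 * dz w)).
  exact: (integrableZl measurableT (a ^+ 2) idz).
have iasz : P.-integrable setT (EFin \o (fun w => 2 * a * b * sz w)).
  exact: (integrableZl measurableT (2 * a * b) isz).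
have ib : P.-integrable setT (EFin \o cst (b ^+ 2)).
  exact: finite_measure_integrable_cst.
have iab := integrableD measurableT iadz iasz.
have FE : (fun w => `|a * \sum_(i < n) g (S i w) - c| ^+ 2) =
    (fun w => a ^+ 2 * dz w + 2 * a * b * sz w + b ^+ 2).
  apply: boolp.funext => w; rewrite real_normK ?num_real//.
  have -> : \sum_(i < n) g (S i w) = sz w + n%:R * m1.
    rewrite /sz /z sumrB sumr_const card_ord -[m1 *+ n]mulr_natl; ring.
  have -> : dz w = sz w * sz w by rewrite /dz /sz big_distrlr.
  by rewrite /b; ring.
rewrite FE unlock.
have -> : (\int[P]_w (a ^+ 2 * dz w + 2 * a * b * sz w + b ^+ 2)%:E)%E =
    (\int[P]_w (a ^+ 2 * dz w + 2 * a * b * sz w + b ^+ 2))%:E.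
  rewrite fineK// integrable_fin_num//.
  exact: (integrableD measurableT iab ib).
rewrite lee_fin RintegralD// RintegralD//.
rewrite (RintegralZl _ measurableT idz) (RintegralZl _ measurableT isz).
rewrite Rintegral_probability_cst szE big1 ?mulr0 ?addr0//.
rewrite lerD2r ler_wpM2l ?sqr_ge0//.
rewrite dzE.
rewrite (le_trans (_ : _ <= \sum_(i < n) m2))//; last first.
  by rewrite sumr_const card_ord mulr_natl.
apply: ler_sum => i _; rewrite (idz1 i).2 (bigD1 i)//= big1 ?addr0//.
by move=> j ji; rewrite zzE// eq_sym.
Qed.
End iid_mean_square.

(** * The kernel density derivative estimator *)

(** At the integer index [m + 2] the strict floor is [m + 1] and the Hölder exponent is [1], so the
    seminorm is a Lipschitz constant. Both suprema are nonnegative, so each is separately at most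
    [L]. *)
Lemma holder_class_natr (R : realType) (m : nat) (L : R) (q : R -> R) :
  holder_class (m.+2)%:R L q ->
  smooth_bounded m.+1 L q /\
  forall u v, `|derive1n m.+1 q u - derive1n m.+1 q v| <= L * `|u - v|.
Proof.
rewrite /holder_class /= strict_floor_natr => -[dq].
set A := (\big[_/_]_(_ <= _ < _) _)%E; set B := ereal_sup _ => ABL.
have supA k x : (k < m.+2)%N -> (`|derive1n k q x|%:E <= A)%E.
  move=> km; apply: (@le_trans _ _
      (ereal_sup (range (fun x : R => (`|derive1n k q x|)%:E)))).
    by apply: ereal_sup_ubound; exists x.
  by apply: (@bigmax_sup_seq _ _ _ _ _ k); rewrite ?mem_index_iota.
have supB u v : u != v -> (
    (`|derive1n m.+1 q u - derive1n m.+1 q v| / `|u - v|)%:E <= B)%E.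
  move=> uv; apply: ereal_sup_ubound; exists (u, v) => //=.
  by rewrite -natrB// subSnn powRr1.
have A0 : (0 <= A)%E by rewrite (le_trans _ (supA 0%N 0 _)) ?lee_fin.
have B0 : (0 <= B)%E.
  by rewrite (le_trans _ (supB 1 0 (oner_neq0 _)))// lee_fin divr_ge0.
have AL : (A <= L%:E)%E by rewrite (le_trans _ ABL)// leeDl.
have BL : (B <= L%:E)%E by rewrite (le_trans _ ABL)// leeDr.
have lipq u v : `|derive1n m.+1 q u - derive1n m.+1 q v| <= L * `|u - v|.
  have [->|uv] := eqVneq u v; first by rewrite !subrr normr0 mulr0.
  rewrite -ler_pdivrMr ?normr_gt0 ?subr_eq0// -lee_fin.
  exact: le_trans (supB u v uv) BL.
split => //; split => //.
  by move=> k x km; rewrite -lee_fin (le_trans (supA k x _)).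
have L0 : 0 <= L by rewrite -lee_fin (le_trans A0).
(* [L] may be [0] here; [L + 1] is a Lipschitz constant by which one can divide. *)
have L1 : 0 < L + 1 by rewrite ltr_wpDl.
move=> x; apply/cvgrPdist_le => e e0; near=> t.
have xt : `|x - t| <= e / (L + 1).
  by near: t; apply: cvgr_dist_le; [exact: cvg_id|rewrite divr_gt0].
rewrite (le_trans (lipq x t))// (le_trans (_ : _ <= (L + 1) * `|x - t|))//.
  by rewrite ler_wpM2r// lerDl.
by rewrite mulrC -ler_pdivlMr.
Unshelve. all: by end_near. Qed.

(** Replaces the real powers of [n] by natural powers of [r], on which [field] and [ring] can
    work. *)
Lemma root_bandwidth (R : realType) (m n : nat)
    (r := n%:R `^ (- (1 / (2 * m + 5)%N%:R)) : R) :
  (0 < n)%N ->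
  [/\ 0 < r, r ^+ (2 * m + 5) = n%:R^-1 &
      n%:R `^ (- (4 / (2 * m + 5)%N%:R)) = r ^+ 4].
Proof.
move=> n0; have d0 : (2 * m + 5)%N%:R != 0 :> R.
  by rewrite pnatr_eq0 addn_eq0 andbF.
split; first by rewrite powR_gt0 ?ltr0n.
  rewrite /r -powR_mulrn ?powR_ge0// -powRrM mulNr divfK//.
  by rewrite powR_inv1.
rewrite /r -powR_mulrn ?powR_ge0// -powRrM; congr (_ `^ _).
by rewrite mulNr mulrAC mul1r.
Qed.

Lemma kde_mse_le (R : realType) (m : nat) :
  exists Cv Cb : R, [/\ 0 <= Cv, 0 <= Cb &
  forall L h y (q : R -> R) (nu : probability R R), 0 < h ->
  has_lebesgue_density nu q -> smooth_bounded m.+1 L q ->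
  (forall u v, `|derive1n m.+1 q u - derive1n m.+1 q v| <= L * `|u - v|) ->
  forall n (d' : measure_display) (T' : measurableType d')
    (P' : probability T' R) (S : 'I_n -> {RV P' >-> R}), (0 < n)%N ->
  iid_sample nu S ->
  ('E_P'[fun w =>
      (`|kde_derivative m h (fun i => S i w) y - derive1n m q y| ^+ 2)%R]
   <= (Cv * L / (n%:R * h ^+ (2 * m + 1)) + (Cb * L * h ^+ 2) ^+ 2)%:E)%E].
Proof.
have [Cv Cv0 HCv] := @scaled_gauss_sqr_le R m.
have [Cb Cb0 HCb] := @gauss_bias_le R.
exists Cv, Cb; split => // L h y q nu h0 nuq qS qL n d' T' P' S n0 iid.
have [dq bq _] := qS.
have [mq q0 _] := nuq.
have [C C0 HC] := @derive1n_gauss_le R m.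
pose g := scaled_gauss m y h.
have gC u : `|g u| <= C.
  by rewrite (le_trans (HC _))// ler_piMr// wide_gauss_le1.
have mg : measurable_fun setT g.
  apply: continuous_measurable_fun; exact: continuous_scaled_gauss.
rewrite /kde_derivative.
apply: (le_trans (iid_mean_square _ _ _ _ nu S g C _ _ iid mg gC)).
rewrite lee_fin; apply: lerD.
  rewrite (Rintegral_density nu q (fun x => g x ^+ 2) (C ^+ 2) nuq)//;
    last 2 first.
  - exact: measurable_funX.
  - by move=> x; rewrite normrX lerXn2r ?nnegrE.
  have I_le := HCv L y h q h0 mq (fun u => bq 0%N u isT).
  rewrite -/g in I_le.
  have nh : n%:R * h ^+ (2 * m + 1) != 0.
    by rewrite mulf_neq0 ?pnatr_eq0 -?lt0n// expf_neq0// gt_eqF.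
  rewrite mulrA; apply: (le_trans (ler_wpM2l _ I_le)).
    by rewrite mulr_ge0 ?sqr_ge0.
  rewrite le_eqVlt; apply/orP; left; apply/eqP.
  rewrite (_ : h ^+ (2 * m + 1) = h ^+ m * h ^+ m * h).
    by rewrite (exprS h m); field; rewrite !gt_eqF ?exprn_gt0 ?ltr0n.
  by rewrite addn1 exprSr mul2n -addnn exprD.
rewrite (Rintegral_density nu q g C nuq)//.
rewrite /g (Rintegral_scaled_gaussM m L q)//; last first.
  split => //.
    by move=> k x km; apply: dq; rewrite ltnW.
    by move=> k x km; apply: bq; rewrite ltnW.
  exact: (smooth_bounded_continuous m.+1 L q m).
set I := \int[_]_u _.
have dg (u : R) : is_derive u 1 (derive1n m q) (derive1n m.+1 q u).
  by rewrite derive1nS derive1E; apply: derivableP; exact: dq.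
have := HCb L y h _ _ h0 dg (fun u => bq m u (leqnSn m)) qL.
rewrite -/I => Ib.
(* The factor [h^m] from the integrations by parts cancels all but one power of the normalisation,
   so the mean of the estimator is [I / h]. *)
have -> : (n%:R * h ^+ m.+1)^-1 * (n%:R * (h ^+ m * I)) - derive1n m q y =
    (I - h * derive1n m q y) / h.
  by rewrite (exprS h m); field; rewrite !gt_eqF ?exprn_gt0 ?ltr0n.
have nn : 0 <= Cb * L * h ^+ 2.
  (* The sign is read off the bias bound itself, which dominates an absolute value. *)
  by have := le_trans (normr_ge0 _) Ib; rewrite exprSr mulrA pmulr_lge0.
rewrite -(real_normK (num_real (_ / h))) lerXn2r ?nnegrE//.
rewrite normrM normfV (gtr0_norm h0) ler_pdivrMr//.
by rewrite [leRHS](_ : _ = Cb * L * h ^+ 3)//; ring.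
Qed.

Theorem theorem4 (R : realType) (m : nat) (L c1 c2 : R)
    (L_gt0 : 0 < L) (c1_gt0 : 0 < c1) (c12 : c1 <= c2) :
  exists C : R,
    forall (d : measure_display) (T : measurableType d) (P : probability T R)
      (X Z Y : {RV P >-> R}) (p : R -> R) (sigma : R) (q : R -> R),
    has_lebesgue_density (distribution P X) p ->
    (forall A : set R, measurable A ->
       distribution P Z A = normal_prob 0 1 A) ->
    independent_pair X Z ->
    0 < sigma ->
    (forall w : T, Y w = X w + sigma * Z w) ->
    has_lebesgue_density (distribution P Y) q ->
    holder_class (m.+2)%:R L q ->
    forall b : nat -> R,
    (forall n : nat, (0 < n)%N ->
       c1 * n%:R `^ (- (1 / (2 * m + 5)%N%:R)) <= b n
         <= c2 * n%:R `^ (- (1 / (2 * m + 5)%N%:R))) ->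
    forall y : R,
    \forall n \near \oo,
      forall (d' : measure_display) (T' : measurableType d')
        (P' : probability T' R) (S : 'I_n -> {RV P' >-> R}),
      iid_sample (distribution P Y) S ->
      ('E_P'[fun w : T' =>
          (`|kde_derivative m (b n) (fun i : 'I_n => S i w) y - derive1n m q y| ^+ 2)%R]
        <= (C * n%:R `^ (- (4 / (2 * m + 5)%N%:R)))%:E)%E.
Proof.
have [Cv [Cb [Cv0 Cb0 mseP]]] := kde_mse_le R m.
(* The variance decreases in the bandwidth and is bounded with [b n >= c1 * r]; the bias bound
   increases and uses [b n <= c2 * r]. *)
exists (Cv * L / c1 ^+ (2 * m + 1) + (Cb * L * c2 ^+ 2) ^+ 2).
move=> d T P X Z Y p sigma q _ _ _ _ _ densq /holder_class_natr[qS qL] b bP y.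
near=> n => d' T' P' S iid.
have n0 : (0 < n)%N by near: n; exists 1%N.
have /andP[b1 b2] := bP n n0.
have [] := root_bandwidth R m n n0; move: b1 b2.
set r := _ `^ (- (1 / _)) => b1 b2 r0 rX ->.
have c2_gt0 : 0 < c2 := lt_le_trans c1_gt0 c12.
have b0 : 0 < b n by rewrite (lt_le_trans _ b1)// mulr_gt0.
have L0 := ltW L_gt0.
apply: (le_trans (mseP L (b n) y q _ b0 densq qS qL n d' T' P' S n0 iid)).
rewrite lee_fin mulrDl; apply: lerD.
  set k := (2 * m + 1)%N.
  (* Here [1/n = r^(2m+5) = r^(k+4)], and [r^k] cancels. *)
  have -> : Cv * L / c1 ^+ k * r ^+ 4 = Cv * L * (n%:R^-1 / (c1 * r) ^+ k).
    rewrite -rX (_ : (2 * m + 5 = k + 4)%N); last by rewrite /k -addnA.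
    by rewrite exprD exprMn; field; rewrite !gt_eqF ?exprn_gt0.
  rewrite invfM ler_wpM2l ?mulr_ge0// ler_wpM2l ?invr_ge0//.
  rewrite lef_pV2 ?posrE ?exprn_gt0 ?mulr_gt0//.
  by rewrite lerXn2r ?nnegrE ?mulr_ge0 ?(ltW r0) ?(ltW c1_gt0) ?(ltW b0).
rewrite (_ : _ * r ^+ 4 = (Cb * L * (c2 * r) ^+ 2) ^+ 2); last by ring.
have bn0 := ltW b0.
rewrite lerXn2r ?nnegrE ?mulr_ge0 ?exprn_ge0 ?(ltW r0) ?(ltW c2_gt0)//.
rewrite ler_wpM2l ?mulr_ge0// lerXn2r ?nnegrE//.
- by rewrite mulr_ge0 ?(ltW r0) ?(ltW c2_gt0).
Unshelve. all: by end_near. Qed.
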